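(* Let $q$ be even, and consider $\mathrm{PGL}_2(q)$ acting on the $3$-subsets of the projective line over $\mathbb{F}_q$. Let $\ell$ be a positive integer. The intersection density of this action is (1) $\frac{q}{6}$, if $q=2^{2\ell+1}$; (2) $\frac{q}{2}$, if $q=2^{2\ell}$.
   Context: $\mathrm{PGL}_2(q)$ acts naturally on the $q+1$ points of the projective line over $\mathbb{F}_q$ (identified with $\{1,\dots,q+1\}$), and hence on its $3$-subsets. For a finite group $G$ acting transitively on a finite set $V$, a subset $\mathcal{F}\subseteq G$ is intersecting if for any $g,h\in\mathcal{F}$ there is $v\in V$ with $g(v)=h(v)$. The intersection density of $G$ in this action is $\rho(G)=\max\{ |\mathcal{F}|\,|V|/|G| : \mathcal{F}\subseteq G \text{ intersecting}\}$. Here $V$ is the set of $3$-subsets of the projective line. *)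

(* Defs.v *)
From HB Require Import structures.
From mathcomp Require Import all_boot all_order all_algebra all_fingroup.
From mathcomp Require Import all_solvable all_field all_character.

Set Implicit Arguments.
Unset Strict Implicit.
Unset Printing Implicit Defensive.

Import Order.TTheory GRing.Theory Num.Theory.

Local Open Scope ring_scope.

Section IntersectionDensity.

Variables (aT : finGroupType) (D : {group aT}) (rT : finType).
Variable to : action D rT.

Definition intersecting (V : {set rT}) (F : {set aT}) : bool :=
  [forall g in F, forall h in F, exists v in V, to v g == to v h].

(* The default value 0 of the maximum is harmless: the empty family is
   intersecting and all the ratios are nonnegative. *)
Definition intersection_density (G : {set aT}) (V : {set rT}) : rat :=
  \big[Order.max/0]_(F : {set aT} | (F \subset G) && intersecting V F)
    (#|F|%:R * #|V|%:R / #|G|%:R).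

End IntersectionDensity.

Section PGL2.

Variable F : finFieldType.

Definition PGL2 : {group coset_of 'Z('GL_2[F])} :=
  ('GL_2[F] / 'Z('GL_2[F]))%G.

(* A point of the projective line is a one-dimensional subspace of F^2, given
   as its set of row vectors. *)
Definition projective_line : {set {set 'rV[F]_2}} :=
  [set [set a *: v | a : F] | v : 'rV[F]_2 & v != 0].

(* MathComp actions are right actions: g maps the row vector v to v *m g, and
   a set of row vectors to its elementwise image.  In the quotient action a
   coset acts as any of its representatives on the sets of vectors stabilised
   by all scalar matrices, in particular on lines (PGL2_set_actionE). *)
Definition PGL2_line_action := (('MR (GLrepr F 1))^* %% 'Z('GL_2[F]))%act.

Definition PGL2_set_action := (PGL2_line_action^*)%act.

Definition three_subsets : {set {set {set 'rV[F]_2}}} :=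
  [set S : {set {set 'rV[F]_2}} | (S \subset projective_line) && (#|S| == 3)].

Lemma GL2_center_scalar (z : {'GL_2[F]}) :
  z \in 'Z('GL_2[F])%g -> exists2 a : F, a != 0 & GLval z = a%:M.
Proof.
case/centerP=> _ zC.
have tvC (i j : 'I_2) : i != j ->
    GLval z *m delta_mx i j = delta_mx i j *m GLval z.
  move=> nij; have d0 : delta_mx i j *m delta_mx i j = 0 :> 'M[F]_2.
    by rewrite mul_delta_mx_cond eq_sym (negbTE nij).
  have tU : (1%:M + delta_mx i j : 'M[F]_2) \in unitmx.
    have /mulmx1_unit[//] :
      (1%:M + delta_mx i j) *m (1%:M - delta_mx i j) = 1%:M :> 'M[F]_2.
    by rewrite mulmxBr mulmx1 mulmxDl mul1mx d0 addr0 addrK.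
  pose t : {'GL_2[F]} := insubd (1%g : {'GL_2[F]}) (1%:M + delta_mx i j).
  have tE : GLval t = 1%:M + delta_mx i j.
    by rewrite -[GLval t]/(val t) val_insubd tU.
  have := congr1 (@GLval _ _) (zC t (in_setT _)); rewrite !GL_ME tE.
  by rewrite -!mulmxE mulmxDr mulmx1 mulmxDl mul1mx => /addrI.
have eqE (i j k l : 'I_2) : i != j ->
    (GLval z *m delta_mx i j) k l = (delta_mx i j *m GLval z) k l.
  by move=> nij; rewrite tvC.
pose a := GLval z ord0 ord0.
have zE : GLval z = a%:M.
  have z10 := eqE ord0 ord_max ord_max ord_max isT.
  have z11 := eqE ord0 ord_max ord0 ord_max isT.
  have z01 := eqE ord_max ord0 ord0 ord0 isT.
  move: z10 z11 z01; rewrite !mxE !big_ord_recl !big_ord0 !mxE /=.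
  have -> : lift ord0 (ord0 : 'I_1) = ord_max :> 'I_2 by apply: val_inj.
  rewrite /= !(mulr0, mul0r, mulr1, mul1r, addr0, add0r).
  move=> z10 z11 z01; apply/matrixP=> i j; rewrite !mxE.
  have ordE (k : 'I_2) : k = ord0 \/ k = ord_max.
    by case: k => [[|[|//]] ?]; [left | right]; apply: val_inj.
  by case: (ordE i) => ->; case: (ordE j) => ->; rewrite /= ?mulr1n ?mulr0n.
exists a => //; apply/eqP=> a0; have := valP z; rewrite -[val z]/(GLval z) zE.
by rewrite a0 unitmxE det_scalar expr0n unitr0.
Qed.

Lemma GL2_set_actE (g : {'GL_2[F]}) (L : {set 'rV[F]_2}) :
  ('MR (GLrepr F 1))^*%act L g = [set v *m GLval g | v in L].
Proof. by apply: eq_imset => v; rewrite /= mx_repr_actE ?inE. Qed.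

Lemma center_stab_line (z : {'GL_2[F]}) (L : {set 'rV[F]_2}) :
  z \in 'Z('GL_2[F])%g -> L \in projective_line ->
  ('MR (GLrepr F 1))^*%act L z = L.
Proof.
case/GL2_center_scalar=> a a0 zE /imsetP[v _ ->]; rewrite GL2_set_actE zE.
apply/setP=> w; apply/imsetP/imsetP=> [[_ /imsetP[b _ ->] ->] | [b _ ->]].
  by exists (a * b); rewrite // mul_mx_scalar scalerA.
exists ((a^-1 * b) *: v); first by apply/imsetP; exists (a^-1 * b).
by rewrite mul_mx_scalar scalerA mulVKf.
Qed.

Lemma PGL2_set_actionE (g : {'GL_2[F]}) (S : {set {set 'rV[F]_2}}) :
  S \subset projective_line ->
  PGL2_set_action S (coset 'Z('GL_2[F]) g) =
    [set [set v *m GLval g | v in L] | L : {set 'rV[F]_2} in S].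
Proof.
move=> /subsetP SP; apply: eq_in_imset => L /SP LP /=.
have gN : g \in 'N('Z('GL_2[F]))%g.
  exact: (subsetP (normal_norm (center_normal _)) _ (in_setT g)).
rewrite modactE ?in_setT //; first exact: GL2_set_actE.
by apply/afixP=> z /setIP[_ zZ]; apply: center_stab_line.
Qed.

End PGL2.

(* Main.v *)
Require Import Defs.
From mathcomp Require Import all_boot all_order all_algebra all_fingroup.
From mathcomp Require Import all_solvable all_field all_character ring.
Set Implicit Arguments.
Unset Strict Implicit.
Import Order.TTheory GRing.Theory Num.Theory.
Local Open Scope ring_scope.

(** Write [q] for the order of [F], a power of 2.  The 3-subsets of the
    projective line number a sixth of the order of PGL_2(q)
    ([card_three_subsets]), so the density is a sixth of the maximal size of an
    intersecting family, and this maximum turns out to be [q] times the number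
    of cube roots of unity in [F].

    Lower bound.  The maps x |-> a x + b with a ^ 3 = 1 are intersecting
    ([affine_family_intersecting]): two of them with the same linear part
    differ by a translation and agree on a 3-set containing infinity, and two
    with distinct linear parts agree at some point p, hence agree as sets on
    the translate by p of the cube roots of unity.

    Upper bound.  Squaring is bijective on [F], so every element of PGL_2(q)
    has a representative of determinant 1.  A matrix of determinant 1 that
    fixes a 3-set acts on it as a permutation of order 1, 2 or 3, which forces
    its trace to be 0 or 1 ([trace_fixed_three_subset]).  Since
    tr (g h^-1) = det (g + h) in characteristic 2, an intersecting family
    becomes a set [M] of matrices of determinant 1 such that det (g + h) lies
    in the prime field for all g, h in [M] ([det_family]).

    View 2 x 2 matrices as a 4-dimensional quadratic space for the determinant.
    If all det (g + h) vanish, one may translate [M] to contain the identity,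
    and then its elements are determined by vectors of a totally isotropic
    subset of a symplectic plane, that is, of a line; hence [M] has at most [q]
    elements ([card_pairwise_singular]).  Otherwise one may multiply [M] on both
    sides so as to contain 1 and the companion matrix w of X^2 + X + 1
    ([card_det_family]).  Every f in [M] then splits orthogonally as n + r, where
    n lies in {0, 1, w, w + 1} and r in the orthogonal plane of 1 and w, on which
    the determinant is again the form x^2 + xy + y^2.  The components r pair into the prime field, so
    they lie on a line or among the 4 combinations of two vectors over the
    prime field: there are at most max(q, 4) of them.  Since det f = 1, each r
    leaves at most 3 choices for n, whence at most 3 q elements.  When q is an
    odd power of 2 and at least 8, X^2 + X + 1 is irreducible, the orthogonal plane is
    anisotropic, and [M] has at most 3 elements with r = 0 and 4 with n = 0;
    all others are excluded, and 7 is less than q. *)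

(** * Characteristic two and a symplectic plane *)

Section Char2.
Variables (F : finFieldType).
Hypothesis ch2 : 2%N \in [pchar F].

(** Polynomial identities of characteristic 2 reduce through this lemma to
    identities valid in every commutative ring. *)
Lemma eq_modulo_double (z x y : F) : x = y + (z + z) -> x = y.
Proof. by rewrite (addrr_pchar2 ch2) addr0. Qed.

Lemma eq_of_add0 (x y : F) : x + y = 0 -> x = y.
Proof. by move/eqP; rewrite addr_eq0 (oppr_pchar2 ch2) => /eqP. Qed.

(** Membership in the prime field. *)
Definition in_F2 (x : F) := (x == 0) || (x == 1).

Lemma in_F2D x y : in_F2 x -> in_F2 y -> in_F2 (x + y).
Proof.
case/orP=> /eqP-> /orP[] /eqP->;
  by rewrite /in_F2 ?add0r ?addr0 ?(addrr_pchar2 ch2) eqxx ?orbT.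
Qed.

Lemma in_F2M x y : in_F2 x -> in_F2 y -> in_F2 (x * y).
Proof.
by case/orP=> /eqP-> /orP[] /eqP->; rewrite /in_F2 ?mul0r ?mulr0 ?mulr1 eqxx ?orbT.
Qed.

Definition alt_form (u v : F * F) : F := u.1 * v.2 + u.2 * v.1.

(** Vectors of a symplectic plane that are pairwise orthogonal are
    proportional, so they all lie on one line. *)
Lemma card_isotropic (S : {set F * F}) :
  {in S &, forall u v, alt_form u v = 0} -> (#|S| <= #|F|)%N.
Proof.
move=> S0.
have [/subset_leq_card Ssub|] := boolP (S \subset [set (0, 0)]).
  apply: leq_trans Ssub _; rewrite cards1.
  exact: ltnW (finNzRing_gt1 F).
case/subsetPn=> -[u1 u2] uS; rewrite in_set1 => u0.
apply: leq_trans (leq_imset_card (fun k : F => (k * u1, k * u2)) predT).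
apply/subset_leq_card/subsetP=> -[v1 v2] vS.
have /eq_of_add0 /= E := S0 _ _ uS vS.
apply/imsetP; have [u10|u10] := eqVneq u1 0.
  have u20 : u2 != 0 by apply: contraNneq u0 => u20; rewrite u10 u20.
  exists (v2 / u2) => //; rewrite u10 mulr0 divfK //; congr (_, _).
  by move: E; rewrite u10 mul0r => /esym/eqP; rewrite mulf_eq0 (negbTE u20) => /eqP.
exists (v1 / u1) => //; rewrite divfK //; congr (_, _).
by apply: (mulfI u10); rewrite E; field.
Qed.

(** Cramer's rule: for u, v with alt_form u v = 1, the coordinates of w in the
    basis u, v are alt_form w v and alt_form w u. *)
Lemma in_span_F2 (S : {set F * F}) u v :
  u \in S -> v \in S -> alt_form u v = 1 ->
  {in S &, forall u v, in_F2 (alt_form u v)} ->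
  S \subset [set (0, 0); u; v; u + v].
Proof.
case: u v => [u1 u2] [v1 v2] uS vS uv S2; apply/subsetP=> -[w1 w2] wS.
have E : (w1, w2) = (alt_form (w1, w2) (v1, v2) * u1 + alt_form (w1, w2) (u1, u2) * v1,
                     alt_form (w1, w2) (v1, v2) * u2 + alt_form (w1, w2) (u1, u2) * v2).
  move: uv; rewrite /alt_form /= => uv; congr (_, _).
    by rewrite -[LHS]mulr1 -uv; apply: (eq_modulo_double (z := - (w2 * u1 * v1))); ring.
  by rewrite -[LHS]mulr1 -uv; apply: (eq_modulo_double (z := - (w1 * u2 * v2))); ring.
rewrite E !inE.
have [/orP[]/eqP-> /orP[]/eqP->] := (S2 _ _ wS vS, S2 _ _ wS uS);
  by rewrite ?mul0r ?mul1r ?add0r ?addr0 ?eqxx ?orbT.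
Qed.

Lemma leq_card_setU1 (T : finType) (A : {set T}) x : (#|A :|: [set x]| <= #|A|.+1)%N.
Proof. by rewrite setUC cardsU1 -add1n leq_add2r leq_b1. Qed.

Lemma card_span (u v : F * F) : (#|[set (0%R, 0%R); u; v; (u + v)%R]| <= 4)%N.
Proof.
by do 3 !apply: leq_trans (leq_card_setU1 _ _) _; rewrite ?ltnS ?cards1.
Qed.

(** * Families of 2 x 2 matrices of determinant one *)

Lemma det_mx22 (R : comNzRingType) (A : 'M[R]_2) :
  \det A = A 0 0 * A 1 1 - A 0 1 * A 1 0.
Proof.
rewrite (expand_det_row _ 0) !big_ord_recl big_ord0 /cofactor !det_mx11 !mxE /=.
have -> : lift ord0 ord0 = 1 :> 'I_2 by apply: val_inj.
have -> : lift 1 0 = 0 :> 'I_2 by apply: val_inj.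
by rewrite -[ord0]/(0 : 'I_2) /= ; ring.
Qed.

Lemma matrix22P (R : Type) (A B : 'M[R]_2) :
  A 0 0 = B 0 0 -> A 0 1 = B 0 1 -> A 1 0 = B 1 0 -> A 1 1 = B 1 1 -> A = B.
Proof.
move=> h00 h01 h10 h11; apply/matrixP=> i j.
have ordE (k : 'I_2) : k = 0 \/ k = 1.
  by case: k => [[|[|//]] ?]; [left | right]; apply: val_inj.
by case: (ordE i) => ->; case: (ordE j) => ->.
Qed.

Lemma sqr_inj2 (x y : F) : x * x = y * y -> x = y.
Proof.
move=> E; apply: eq_of_add0; apply/eqP; rewrite -[_ == 0]orbb -mulf_eq0; apply/eqP.
apply: (eq_modulo_double (z := x * x + x * y)).
by rewrite mulrDl !mulrDr -E; ring.
Qed.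

(** Taking g = 1 shows that the two diagonal entries of f are equal; their
    square is 1 + bc for the off-diagonal entries b and c, so that (b, c)
    determines f.  On these pairs det (f + g) is the symplectic form. *)
Lemma card_pairwise_singular (M : {set 'M[F]_2}) :
  {in M, forall f, \det f = 1} -> 1 \in M ->
  {in M &, forall f g, \det (f + g) = 0} -> (#|M| <= #|F|)%N.
Proof.
move=> M1 oneM M0.
have diag f : f \in M -> f 1 1 = f 0 0.
  move=> fM; apply: eq_of_add0.
  have := M0 _ _ fM oneM; have := M1 _ fM; rewrite !det_mx22 !mxE /=.
  rewrite !mulr1n !mulr0n => D1 D0.
  transitivity (f 0 0 * f 1 1 - f 0 1 * f 1 0 + 1 + (f 1 1 + f 0 0)).
    by rewrite D1 (addrr_pchar2 ch2) add0r.
  by rewrite -[RHS]D0; ring.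
have inj : {in M &, injective (fun f : 'M[F]_2 => (f 0 1, f 1 0))}.
  move=> f g fM gM [E01 E10]; have := M1 _ fM; rewrite -(M1 _ gM) !det_mx22.
  rewrite !diag // E01 E10 => /addIr/sqr_inj2 E00.
  by apply: matrix22P => //; rewrite !diag.
rewrite -(card_in_imset inj); apply: card_isotropic.
move=> _ _ /imsetP[f fM ->] /imsetP[g gM ->].
transitivity (\det (f + g) + (\det f + \det g)).
  rewrite !det_mx22 !mxE /alt_form /= !diag //.
  apply: (eq_modulo_double (z := f 0 1 * g 1 0 + f 1 0 * g 0 1 - f 0 0 * f 0 0
    - g 0 0 * g 0 0 - f 0 0 * g 0 0 + f 0 1 * f 1 0 + g 0 1 * g 1 0)).
  ring.
by rewrite M0 // !M1 // (addrr_pchar2 ch2) addr0.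
Qed.

(** The companion matrix of X^2 + X + 1: it has trace 1 and determinant 1. *)
Definition omega_mx : 'M[F]_2 := \matrix_(i, j) ((i != 0) || (j != 0))%:R.

(** The norm form of the algebra F[X] / (X^2 + X + 1); its polar form is
    [alt_form]. *)
Definition qform (u : F * F) : F := u.1 * u.1 + u.1 * u.2 + u.2 * u.2.

(** The coordinates of the components of f in the decomposition of the matrix
    space as the orthogonal sum of the span of 1 and [omega_mx], with this
    basis, and of the plane of the matrices with rows (x, y) and (x + y, x).
    Restricted to either plane, the determinant is [qform]. *)
Definition F4_part (f : 'M[F]_2) := (f 0 0 + f 0 1 + f 1 0, f 0 0 + f 1 1).
Definition orth_part (f : 'M[F]_2) := (f 0 1 + f 1 0, f 0 0 + f 0 1 + f 1 1).

Lemma parts_inj f g : F4_part f = F4_part g -> orth_part f = orth_part g -> f = g.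
Proof.
case=> n1 n2 [r1 r2].
have E00 : f 0 0 = g 0 0.
  by move: n1; rewrite -!addrA r1 => /addIr.
have E01 : f 0 1 = g 0 1.
  by move: r2; rewrite -!(addrAC _ (_ 1 1)) n2 => /addrI.
apply: matrix22P => //.
  by move: r1; rewrite E01 => /addrI.
by move: n2; rewrite E00 => /addrI.
Qed.

Lemma det_parts f : \det f = qform (F4_part f) + qform (orth_part f).
Proof.
rewrite det_mx22 /qform /=.
set a := f 0 0; set b := f 0 1; set c := f 1 0; set d := f 1 1.
apply: (eq_modulo_double (z := - (2 * a * a + 3 * a * b + 2 * a * c
  + 2 * b * b + 3 * b * c + c * c + 2 * a * d + 2 * b * d + c * d + d * d))).
ring.
Qed.

(** The polar form of the determinant is the orthogonal sum of those of its
    restrictions to the two planes. *)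
Lemma alt_orth_part f g :
  alt_form (orth_part f) (orth_part g) =
  \det (f + g) + \det f + \det g + alt_form (F4_part f) (F4_part g).
Proof.
rewrite !det_mx22 !mxE /alt_form /=.
set a := f 0 0; set b := f 0 1; set c := f 1 0; set d := f 1 1.
set a' := g 0 0; set b' := g 0 1; set c' := g 1 0; set d' := g 1 1.
apply: (eq_modulo_double (z := b * b' + b' * c + b * c' - a * d - a * d' - a' * d
  - a' * d' + b * c + b' * c' - a * a')).
ring.
Qed.

Lemma qform_F2 (u : F * F) : in_F2 u.1 -> in_F2 u.2 -> qform u = (u != (0, 0))%:R.
Proof.
case: u => u1 u2 /= /orP[]/eqP-> /orP[]/eqP->; rewrite /qform /= ?mul0r ?mulr0 ?mulr1;
  by rewrite ?(add0r, addr0, addrr_pchar2 ch2) xpair_eqE ?oner_eq0 ?eqxx.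
Qed.

Section NormalizedFamily.
Variable M : {set 'M[F]_2}.
Hypotheses (M1 : {in M, forall f, \det f = 1}) (oneM : 1 \in M) (omegaM : omega_mx \in M).
Hypothesis M2 : {in M &, forall f g, in_F2 (\det (f + g))}.

(** The two coordinates are det (f + omega_mx) and det (f + 1). *)
Lemma F4_part_F2 : {in M, forall f, in_F2 (F4_part f).1 /\ in_F2 (F4_part f).2}.
Proof.
move=> f fM; split=> /=.
  have -> : f 0 0 + f 0 1 + f 1 0 = \det (f + omega_mx) + (\det f + 1).
    rewrite !det_mx22 !mxE /=.
    apply: (eq_modulo_double (z := - (f 0 0 * f 1 1) + f 0 1 * f 1 0 + f 0 1 + f 1 0)).
    by ring.
  by rewrite (M1 fM) (addrr_pchar2 ch2) addr0 M2.
have -> : f 0 0 + f 1 1 = \det (f + 1) + (\det f + 1).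
  rewrite !det_mx22 !mxE /= mulr1n mulr0n.
  apply: (eq_modulo_double (z := - (f 0 0 * f 1 1) + f 0 1 * f 1 0 - 1)).
  by ring.
by rewrite (M1 fM) (addrr_pchar2 ch2) addr0 M2.
Qed.

Lemma orth_part_F2 :
  {in M &, forall f g, in_F2 (alt_form (orth_part f) (orth_part g))}.
Proof.
move=> f g fM gM; rewrite alt_orth_part (M1 fM) (M1 gM).
have [f1 f2] := F4_part_F2 fM; have [g1 g2] := F4_part_F2 gM.
have one2 : in_F2 1 by rewrite /in_F2 eqxx orbT.
by rewrite !in_F2D ?M2 // in_F2M.
Qed.

(** On pairs over the prime field [qform] is 1 except at the origin, and
    det f = 1 is the sum of the values of [qform] at both components. *)
Lemma qform_orth_part :
  {in M, forall f, qform (orth_part f) = (F4_part f == (0, 0))%:R}.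
Proof.
move=> f fM; have := det_parts f; have [f1 f2] := F4_part_F2 fM.
rewrite M1 // qform_F2 //; case: eqP => _ /=; first by rewrite add0r.
by rewrite -[LHS]addr0 => /addrI.
Qed.

Lemma card_orth_parts : (4 <= #|F|)%N -> (#|orth_part @: M| <= #|F|)%N.
Proof.
move=> F4; set S := orth_part @: M.
have S2 : {in S &, forall u v, in_F2 (alt_form u v)}.
  by move=> _ _ /imsetP[f fM ->] /imsetP[g gM ->]; apply: orth_part_F2.
have [/existsP[u /andP[uS /existsP[v /andP[vS /eqP uv]]]]|S0] :=
    boolP [exists u in S, exists v in S, alt_form u v == 1].
  apply: leq_trans F4; apply: leq_trans (card_span u v).
  exact/subset_leq_card/in_span_F2.
apply: card_isotropic => u v uS vS; apply/eqP; move: (S2 _ _ uS vS) => /orP[//|uv1].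
case/negP: S0; apply/existsP; exists u; rewrite uS; apply/existsP; exists v.
by rewrite vS.
Qed.

Definition nonzero_F2 : {set F * F} := [set (1, 0); (0, 1); (1, 1)].

Lemma card_nonzero_F2 : (#|nonzero_F2| <= 3)%N.
Proof.
by do 2 !apply: leq_trans (leq_card_setU1 _ _) _; rewrite ?ltnS ?cards1.
Qed.

Lemma F4_part_nonzero f :
  f \in M -> F4_part f != (0, 0) -> F4_part f \in nonzero_F2.
Proof.
move=> fM; have [] := F4_part_F2 fM; case: (F4_part f) => x y /=.
by move=> /orP[]/eqP-> /orP[]/eqP->; rewrite !inE !eqxx ?orbT.
Qed.

(** Whether the first component n of f vanishes is determined by the orthogonal
    component, so n = 0 may share its code with a nonzero pair: three codes
    suffice. *)
Lemma card_normalized_family : (4 <= #|F|)%N -> (#|M| <= #|F| * 3)%N.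
Proof.
move=> F4.
pose code f := (orth_part f, if F4_part f == (0, 0) then (1, 1) else F4_part f).
have inj : {in M &, injective code}.
  move=> f g fM gM [Er1 Er2 En].
  have Er : orth_part f = orth_part g by congr (_, _).
  have := qform_orth_part fM; rewrite Er qform_orth_part //.
  move=> E; apply: parts_inj Er.
  move: E En; case: eqP => [->|_]; case: eqP => [->|_] //= /eqP.
    by rewrite oner_eq0.
  by rewrite eq_sym oner_eq0.
rewrite -(card_in_imset inj).
apply: leq_trans (_ : #|setX (orth_part @: M) nonzero_F2| <= _)%N; last first.
  by rewrite cardsX leq_mul ?card_orth_parts ?card_nonzero_F2.
apply/subset_leq_card/subsetP=> _ /imsetP[f fM ->]; rewrite in_setX imset_f //=.
by case: ifPn => [_|/F4_part_nonzero->//]; rewrite !inE eqxx !orbT.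
Qed.

(** Anisotropy forces the orthogonal component of f to vanish as soon as the
    first one does not.  The remaining f have n = 0, and their orthogonal
    components r satisfy qform r = 1; if two distinct ones were orthogonal their
    sum would be isotropic. *)
Lemma card_normalized_family_anisotropic :
  (forall x : F, x * x + x + 1 != 0) -> (#|M| <= 7)%N.
Proof.
move=> anis.
have q0 u : qform u = 0 -> u = (0, 0).
  case: u => u1 u2; rewrite /qform /=; have [->|u2n0] := eqVneq u2 0.
    by rewrite !mulr0 !addr0 => /eqP; rewrite mulf_eq0 orbb => /eqP->.
  move=> E; have := anis (u1 / u2); case/eqP; apply: (mulfI (mulf_neq0 u2n0 u2n0)).
  by rewrite mulr0 -[RHS]E; field.
rewrite -(cardsID [set f | F4_part f == (0, 0)] M) addnC (@leq_add _ _ 3 4) //.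
  rewrite -(@card_in_imset _ _ F4_part).
    apply: leq_trans card_nonzero_F2; apply/subset_leq_card/subsetP.
    move=> _ /imsetP[f /setDP[fM f0] ->].
    by apply: F4_part_nonzero => //; move: f0; rewrite inE.
  move=> f g; rewrite !inE => /andP[/negbTE f0 fM] /andP[/negbTE g0 gM] E.
  apply: (parts_inj E); have := qform_orth_part fM; have := qform_orth_part gM.
  by rewrite f0 g0 => /q0-> /q0->.
set A := M :&: _.
have Ainj : {in A &, injective orth_part}.
  move=> f g; rewrite !inE => /andP[_ /eqP f0] /andP[_ /eqP g0]; apply: parts_inj.
  by rewrite f0.
rewrite -(card_in_imset Ainj); set S := orth_part @: A.
have S2 : {in S &, forall u v, in_F2 (alt_form u v)}.
  move=> _ _ /imsetP[f fA ->] /imsetP[g gA ->]; move: fA gA; rewrite !inE.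
  by move=> /andP[fM _] /andP[gM _]; apply: orth_part_F2.
have Sq : {in S, forall u, qform u = 1}.
  by move=> _ /imsetP[f /setIP[fM f0] ->]; move: f0; rewrite qform_orth_part // inE => ->.
have [/existsP[u /andP[uS /existsP[v /andP[vS /eqP uv]]]]|S0] :=
    boolP [exists u in S, exists v in S, alt_form u v == 1].
  apply: leq_trans (card_span u v); exact/subset_leq_card/in_span_F2.
suff: (#|S| <= 1)%N by move=> S1; apply: leq_trans S1 _.
apply/card_le1_eqP => u v uS vS; have Suv := S2 _ _ uS vS.
have alt0 : alt_form u v = 0.
  case/orP: Suv => /eqP// uv; case/negP: S0; apply/existsP; exists u; rewrite uS.
  by apply/existsP; exists v; rewrite vS uv eqxx.
have /q0[/eq_of_add0 E1 /eq_of_add0 E2] : qform (u.1 + v.1, u.2 + v.2) = 0.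
  transitivity (qform u + qform v + alt_form u v).
    rewrite /qform /alt_form /=.
    by apply: (eq_modulo_double (z := u.1 * v.1 + u.2 * v.2)); ring.
  by rewrite alt0 addr0 !Sq // (addrr_pchar2 ch2).
by case: u v E1 E2 {uS vS Suv alt0} => ? ? [? ?] /= -> ->.
Qed.
End NormalizedFamily.

(** * Normalization of a family *)

Lemma mulmx22E (R : comNzRingType) (A B : 'M[R]_2) i j :
  (A *m B) i j = A i 0 * B 0 j + A i 1 * B 1 j.
Proof.
rewrite mxE !big_ord_recl big_ord0 addr0; congr (_ * _ + A i _ * B _ j); exact: val_inj.
Qed.

Definition mx22 (R : Type) (a b c d : R) : 'M[R]_2 :=
  \matrix_(i, j) if i == 0 then if j == 0 then a else b else if j == 0 then c else d.

(** By Cayley-Hamilton g^2 = g + 1, so the matrix K with rows v and v g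
    conjugates g to its companion matrix.  It is invertible unless v is an
    eigenvector of g, and the three nonzero vectors over the prime field are not
    all eigenvectors, since g has trace 1 and so is not scalar. *)
Lemma conj_omega_mx (g : 'M[F]_2) : \det g = 1 -> \det (1 + g) = 1 ->
  exists2 K, K \in unitmx & K *m g = omega_mx *m K.
Proof.
rewrite !det_mx22 !mxE /= mulr1n !add0r => dg tg.
set a := g 0 0 in dg tg *; set b := g 0 1 in dg tg *; set c := g 1 0 in dg tg *.
have g11 : g 1 1 = a + 1.
  have E : (1 + a) * (1 + g 1 1) - b * c = a * g 1 1 - b * c + 1 + (g 1 1 + a) by ring.
  move: E; rewrite tg dg (addrr_pchar2 ch2) add0r => E.
  by apply: eq_of_add0; rewrite addrA -E (addrr_pchar2 ch2).
have bc : b * c = a * a + a + 1.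
  rewrite -dg g11; apply: (eq_modulo_double (z := b * c - a * a - a)); ring.
pose K v w := mx22 v w (v * a + w * c) (v * b + w * (a + 1)).
have KP v w : K v w *m g = omega_mx *m K v w.
  apply: matrix22P; rewrite !mulmx22E !mxE /= -/a -/b -/c ?g11.
  - by ring.
  - by ring.
  - rewrite [LHS](_ : _ = v * (a * a + b * c) + w * (c * (a + a + 1))); last by ring.
    by rewrite bc; apply: (eq_modulo_double (z := v * a * a + w * c * a)); ring.
  - rewrite [LHS](_ : _ = v * (b * (a + a + 1)) + w * (b * c + (a + 1) * (a + 1)));
      last by ring.
    rewrite bc; apply: (eq_modulo_double (z := v * b * a + w * a * a + w * a)); ring.
have [b0|b0] := eqVneq b 0; last first.
  exists (K 1 0) => //; rewrite unitmxE det_mx22 !mxE /= unitfE.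
  by rewrite (_ : _ - _ = b) //; ring.
have [c0|c0] := eqVneq c 0; last first.
  exists (K 0 1) => //; rewrite unitmxE det_mx22 !mxE /= unitfE.
  by rewrite (_ : _ - _ = - c) ?oppr_eq0 //; ring.
exists (K 1 1) => //; rewrite unitmxE det_mx22 !mxE /= unitfE b0 c0.
by rewrite (_ : _ - _ = 1) ?oner_eq0 //; ring.
Qed.

Definition det_family (M : {set 'M[F]_2}) :=
  {in M, forall f, \det f = 1} /\ {in M &, forall f g, in_F2 (\det (f + g))}.

(** Two-sided multiplications with det X * det Y = 1 preserve the determinant,
    hence its polar form. *)
Lemma det_family_equiv (M : {set 'M[F]_2}) (X Y : 'M[F]_2) :
  \det X * \det Y = 1 -> det_family M ->
  det_family [set X *m f *m Y | f in M] /\ #|[set X *m f *m Y | f in M]| = #|M|.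
Proof.
move=> XY [M1 M2].
have XYd f : \det (X *m f *m Y) = \det f by rewrite !det_mulmx mulrAC XY mul1r.
have [Xu Yu] : X \in unitmx /\ Y \in unitmx.
  by apply/andP; rewrite !unitmxE -unitrM XY unitr1.
split; last first.
  by apply: card_imset => f g /(can_inj (mulmxK Yu))/(can_inj (mulKmx Xu)).
split=> [_ /imsetP[f fM ->]|_ _ /imsetP[f fM ->] /imsetP[g gM ->]].
  by rewrite XYd M1.
by rewrite -mulmxDl -mulmxDr XYd M2.
Qed.

Lemma det_family_translate (M : {set 'M[F]_2}) h : det_family M -> h \in M ->
  let M' := [set invmx h *m f *m 1%:M | f in M] in
  [/\ det_family M', #|M'| = #|M| & 1 \in M'].
Proof.
move=> MP hM M'; have h1 := MP.1 _ hM.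
have [|M'P cM'] := @det_family_equiv M (invmx h) 1%:M _ MP.
  by rewrite det_inv h1 invr1 det1 mulr1.
split=> //; apply/imsetP; exists h => //.
by rewrite mulVmx ?mulmx1 // unitmxE h1 unitr1.
Qed.

(** The dichotomy: either all det (g + h) vanish, or some det (h + g) = 1, and
    then h and g can be moved to 1 and [omega_mx]. *)
Lemma card_det_family (M : {set 'M[F]_2}) : det_family M ->
  ((4 <= #|F|)%N -> (#|M| <= #|F| * 3)%N) /\
  ((8 <= #|F|)%N -> (forall x : F, x * x + x + 1 != 0) -> (#|M| <= #|F|)%N).
Proof.
move=> MP.
have [/existsP[h /andP[hM /existsP[g /andP[gM /eqP hg]]]]|M0] :=
    boolP [exists h in M, exists g in M, \det (h + g) == 1]; last first.
  suff: (#|M| <= #|F|)%N by move=> le; split=> // _; rewrite (leq_trans le) ?leq_pmulr.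
  have [->|[h hM]] := set_0Vmem M; first by rewrite cards0.
  have [M'P <- M'1] := det_family_translate MP hM.
  apply: card_pairwise_singular => //; first by case: M'P.
  have h1 := MP.1 _ hM.
  move=> _ _ /imsetP[f fM ->] /imsetP[g gM ->].
  rewrite -mulmxDl -mulmxDr !det_mulmx det1 mulr1 det_inv h1 invr1 mul1r.
  apply/eqP; case/orP: (MP.2 _ _ fM gM) => // fg; case/negP: M0.
  by apply/existsP; exists f; rewrite fM; apply/existsP; exists g; rewrite gM.
have [M'P <- M'1] := det_family_translate MP hM.
set M' := imset _ _ in M'P M'1 *.
have h1 := MP.1 _ hM.
pose g' := invmx h *m g *m 1%:M.
have g'M : g' \in M' by apply: imset_f.
have g'1 := M'P.1 _ g'M.
have g't : \det (1 + g') = 1.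
  have -> : 1 + g' = invmx h *m (h + g).
    by rewrite mulmxDr mulVmx ?unitmxE ?h1 ?unitr1 // /g' mulmx1.
  by rewrite det_mulmx det_inv h1 invr1 mul1r.
have [K Ku Kg] := conj_omega_mx g'1 g't.
have [|M''P <-] := @det_family_equiv M' K (invmx K) _ M'P.
  by rewrite det_inv mulrV // -unitmxE.
set M'' := imset _ _ in M''P *.
have oneM : 1 \in M'' by apply/imsetP; exists 1 => //; rewrite mulmx1 mulmxV.
have omegaM : omega_mx \in M''.
  by apply/imsetP; exists g' => //; rewrite Kg mulmxK.
case: M''P => M''1 M''2; split=> [F4|F8 anis]; first exact: card_normalized_family.
by apply: leq_trans (card_normalized_family_anisotropic _ _ _ _ anis) (ltnW F8).
Qed.
End Char2.

(** * Matrices of determinant one fixing a 3-set of lines *)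

Section Lines.
Variable F : finFieldType.
Implicit Types (u v w : 'rV[F]_2) (A B : 'M[F]_2).

Local Notation Z := ('Z('GL_2[F])%g).

Definition line v : {set 'rV[F]_2} := [set a *: v | a : F].

Lemma mem_line v : v \in line v.
Proof. by apply/imsetP; exists 1; rewrite ?scale1r. Qed.

Lemma line_scale a v : a != 0 -> line (a *: v) = line v.
Proof.
move=> a0; apply/setP=> w; apply/imsetP/imsetP=> -[b _ ->].
  by exists (b * a); rewrite ?scalerA.
by exists (b / a); rewrite // scalerA divfK.
Qed.

Lemma lineP u v : u != 0 -> reflect (exists2 a, a != 0 & u = a *: v) (line u == line v).
Proof.
move=> u0; apply: (iffP eqP) => [E|[a a0 ->]]; last exact: line_scale.
have := mem_line u; rewrite E => /imsetP[a _ ua]; exists a => //.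
by apply: contraNneq u0 => a0; rewrite ua a0 scale0r.
Qed.

Lemma line_mulmx A v : [set w *m A | w in line v] = line (v *m A).
Proof.
apply/setP=> w; apply/imsetP/imsetP=> [[_ /imsetP[a _ ->] ->]|[a _ ->]].
  by exists a; rewrite // scalemxAl.
by exists (a *: v); [apply: imset_f | rewrite -scalemxAl].
Qed.

Definition cross u v : F := u 0 0 * v 0 1 - u 0 1 * v 0 0.

Lemma row2P u v : u 0 0 = v 0 0 -> u 0 1 = v 0 1 -> u = v.
Proof.
move=> h0 h1; apply/rowP=> i.
case: i => [[|[|//]] ?]; [move: h0 | move: h1];
  by congr (_ = _); congr (fun_of_matrix _ _ _); apply: val_inj.
Qed.

Lemma mulmx_row2E u A j : (u *m A) 0 j = u 0 0 * A 0 j + u 0 1 * A 1 j.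
Proof.
rewrite mxE !big_ord_recl big_ord0 addr0; congr (_ * _ + u _ _ * A _ j); exact: val_inj.
Qed.

Lemma crossZl a u v : cross (a *: u) v = a * cross u v.
Proof. by rewrite /cross !mxE; ring. Qed.
Lemma crossC u v : cross u v = - cross v u.
Proof. by rewrite /cross; ring. Qed.
Lemma crossZr a u v : cross u (a *: v) = a * cross u v.
Proof. by rewrite /cross !mxE; ring. Qed.
Lemma cross0 u : cross u u = 0.
Proof. by rewrite /cross; ring. Qed.

(** The trace and the determinant of A describe the action of A on the
    determinant [cross] of pairs of row vectors, without choosing a basis. *)
Lemma cross_trace A u v :
  cross (u *m A) v + cross u (v *m A) = \tr A * cross u v.
Proof.
rewrite /cross !mulmx_row2E /mxtrace !big_ord_recl big_ord0.
have -> : lift ord0 (ord0 : 'I_1) = 1 :> 'I_2 by apply: val_inj.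
by rewrite -[ord0]/(0 : 'I_2); ring.
Qed.

Lemma cross_det A u v : cross (u *m A) (v *m A) = \det A * cross u v.
Proof. by rewrite /cross !mulmx_row2E det_mx22; ring. Qed.

Lemma cross_neq0 u v : u != 0 -> v != 0 -> line u != line v -> cross u v != 0.
Proof.
move=> u0 v0; apply: contraNneq => E; apply/lineP => //.
have {}E : u 0 0 * v 0 1 = u 0 1 * v 0 0 by apply/eqP; rewrite -subr_eq0; apply/eqP.
have [v00|v00] := eqVneq (v 0 0) 0.
  have v01 : v 0 1 != 0.
    by apply: contraNneq v0 => v01; apply/eqP/row2P; rewrite !mxE.
  have u00 : u 0 0 = 0.
    by move/eqP: E; rewrite v00 mulr0 mulf_eq0 (negbTE v01) orbF => /eqP.
  exists (u 0 1 / v 0 1); last by apply: row2P; rewrite mxE ?divfK // v00 mulr0.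
  rewrite mulf_eq0 invr_eq0 (negbTE v01) orbF.
  by apply: contraNneq u0 => u01; apply/eqP/row2P; rewrite !mxE.
have E2 : u = (u 0 0 / v 0 0) *: v.
  apply: row2P; rewrite mxE ?divfK //; apply: (mulIf v00); rewrite -E; field.
  exact: v00.
exists (u 0 0 / v 0 0) => //.
by apply: contraNneq u0 => a0; rewrite E2 a0 scale0r.
Qed.

(** In the basis u, v the matrix A is antidiagonal. *)
Lemma trace_swap A u v a b : cross u v != 0 ->
  u *m A = a *: v -> v *m A = b *: u -> \tr A = 0.
Proof.
move=> uv uA vA; have := cross_trace A u v.
rewrite uA vA crossZl crossZr !cross0 !mulr0 addr0 => /esym/eqP.
by rewrite mulf_eq0 (negbTE uv) orbF => /eqP.
Qed.

(** Write [x, y] for cross x y, t for the trace and d for the determinant of A.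
    The identity [cross_trace] gives b [u, w] = t [u, v] and
    a [w, v] = t [w, u], while [cross_det] gives a b [v, w] = d [u, v]; hence
    t^2 [u, v] = d [u, v]. *)
Lemma trace_cycle3 A u v w a b c : cross u v != 0 ->
  u *m A = a *: v -> v *m A = b *: w -> w *m A = c *: u -> \tr A ^+ 2 = \det A.
Proof.
move=> uv uA vA wA.
have E1 := cross_trace A u v; have E2 := cross_trace A w u; have D := cross_det A u v.
rewrite uA vA crossZl crossZr cross0 mulr0 add0r in E1.
rewrite wA uA crossZl crossZr cross0 mulr0 add0r in E2.
rewrite uA vA crossZl crossZr in D.
apply: (mulIf uv); rewrite -D expr2 -mulrA -E1 (crossC v w) -[a * _]opprK.
transitivity (- b * (\tr A * cross w u)); first by rewrite (crossC u w); ring.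
by rewrite -E2; ring.
Qed.

Lemma images_independent A u v x a b : \det A = 1 -> cross u v != 0 ->
  u *m A = a *: x -> v *m A = b *: x -> False.
Proof.
move=> A1 uv uA vA; have := cross_det A u v.
by rewrite uA vA crossZl crossZr cross0 !mulr0 A1 mul1r => /esym/eqP; apply/negP.
Qed.

Section Char2.
Hypothesis ch2 : 2%N \in [pchar F].

(** The eigenvalues on any two of the three lines add up to the trace; summing
    over the three pairs gives 3 tr A = 2 (a + b + c). *)
Lemma trace_fix3 A u v w a b c : cross u v != 0 -> cross u w != 0 -> cross v w != 0 ->
  u *m A = a *: u -> v *m A = b *: v -> w *m A = c *: w -> \tr A = 0.
Proof.
have eq_tr x y p r : cross x y != 0 -> x *m A = p *: x -> y *m A = r *: y -> p + r = \tr A.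
  move=> xy xA yA; apply: (mulIf xy); rewrite -cross_trace xA yA crossZl crossZr; ring.
move=> uv uw vw uA vA wA.
have E1 := eq_tr _ _ _ _ uv uA vA; have E2 := eq_tr _ _ _ _ uw uA wA.
have E3 := eq_tr _ _ _ _ vw vA wA.
have : a + b + ((a + c) + (b + c)) = 0.
  by rewrite -[RHS](addrr_pchar2 ch2 (a + b + c)); ring.
by rewrite E1 E2 E3 (addrr_pchar2 ch2) addr0.
Qed.

(** The permutation induced on the 3-set is the identity, a transposition or a
    3-cycle; the trace is 0 in the first two cases, and its square is det A in
    the last one. *)
Lemma trace_fixed_three_subset A (S : {set {set 'rV[F]_2}}) :
  \det A = 1 -> S \in three_subsets F ->
  [set [set v *m A | v in L] | L : {set 'rV[F]_2} in S] = S ->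
  in_F2 (\tr A).
Proof.
move=> A1; rewrite inE => /andP[/subsetP SP /eqP cS] AS.
have Au : A \in unitmx by rewrite unitmxE A1 unitr1.
have /card_gt2P[L1 [L2 [L3 [[L1S L2S L3S] [n12 n23 n31]]]]] : (2 < #|S|)%N by rewrite cS.
have inS L : L \in S -> [|| L == L1, L == L2 | L == L3].
  have/eqP -> : S == [set L1; L2; L3]; last by rewrite !inE orbA.
  rewrite eq_sym eqEcard cS; apply/andP; split.
    by apply/subsetP=> L'; rewrite !inE => /orP[/orP[]|] /eqP->.
  by rewrite -setUA !cardsU1 !inE cards1 (eq_sym L1 L3) negb_or n12 n31 n23.
have vec L : L \in S -> exists2 v, v != 0 & L = line v.
  by move/SP/imsetP=> [v]; rewrite inE => v0 EL; exists v.
have [u u0 E1] := vec _ L1S; have [v v0 E2] := vec _ L2S; have [w w0 E3] := vec _ L3S.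
subst L1 L2 L3.
have act x : x != 0 -> line x \in S ->
    [\/ exists a, x *m A = a *: u, exists a, x *m A = a *: v | exists a, x *m A = a *: w].
  move=> x0 xS; have xA0 : x *m A != 0.
    by apply: contraNneq x0 => xA; rewrite -(mulmxK Au x) xA mul0mx.
  have /inS : line (x *m A) \in S by rewrite -line_mulmx -AS imset_f.
  by case/or3P=> /(lineP _ xA0)[a _ E];
     [constructor 1 | constructor 2 | constructor 3]; exists a.
have uv := cross_neq0 u0 v0 n12; have vw := cross_neq0 v0 w0 n23.
have wu := cross_neq0 w0 u0 n31.
have uw : cross u w != 0 by rewrite crossC oppr_eq0.
have vu : cross v u != 0 by rewrite crossC oppr_eq0.
have wv : cross w v != 0 by rewrite crossC oppr_eq0.
suff [->|t2] : \tr A = 0 \/ \tr A ^+ 2 = \det A.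
- by rewrite /in_F2 eqxx.
- have -> : \tr A = 1 by apply: (sqr_inj2 ch2); rewrite -expr2 t2 A1 mulr1.
  by rewrite /in_F2 eqxx orbT.
(* Of the 27 assignments of the lines of u A, v A, w A to those of u, v, w, the
   21 that are not injective contradict the invertibility of A. *)
case: (act _ u0 L1S) => -[a uA]; case: (act _ v0 L2S) => -[b vA];
case: (act _ w0 L3S) => -[c wA];
try by [case: (images_independent A1 uv uA vA)
       | case: (images_independent A1 uw uA wA)
       | case: (images_independent A1 vw vA wA)].
- by left; apply: trace_fix3 uv uw vw uA vA wA.
- by left; apply: trace_swap vw vA wA.
- by left; apply: trace_swap uv uA vA.
- by right; apply: trace_cycle3 uv uA vA wA.
- by right; apply: trace_cycle3 uw uA wA vA.
- by left; apply: trace_swap uw uA wA.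
Qed.

Lemma det_add1 A : \det A = 1 -> \det (A + 1) = \tr A.
Proof.
move=> A1; have -> : \det (A + 1) = \det A + \tr A + 1.
  rewrite !det_mx22 !mxE /mxtrace !big_ord_recl big_ord0.
  have -> : lift ord0 (ord0 : 'I_1) = 1 :> 'I_2 by apply: val_inj.
  by rewrite -[ord0]/(0 : 'I_2) /=; ring.
by rewrite A1 addrAC (addrr_pchar2 ch2) add0r.
Qed.

(** * Determinant one representatives of the cosets *)

Definition mkGL A : {'GL_2[F]} := insubd (1%g : {'GL_2[F]}) A.

Lemma mkGLK A : A \in unitmx -> GLval (mkGL A) = A.
Proof. by move=> Au; rewrite -[GLval _]/(val _) val_insubd Au. Qed.

Lemma mkGL_scalar_center (a : F) : a != 0 -> mkGL a%:M \in Z.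
Proof.
move=> a0; apply/centerP; split=> [|g _]; first exact: in_setT.
apply: val_inj; rewrite -![val _]/(GLval _) !GL_ME mkGLK; last first.
  by rewrite unitmxE det_scalar unitrX ?unitfE.
by rewrite -!mulmxE scalar_mxC.
Qed.

Lemma set_action_mulmx (A B : 'M[F]_2) (S : {set {set 'rV[F]_2}}) :
  [set [set v *m (A *m B) | v in L] | L : {set 'rV[F]_2} in S] =
  [set [set v *m B | v in L] | L : {set 'rV[F]_2} in
    [set [set v *m A | v in L] | L : {set 'rV[F]_2} in S]].
Proof.
rewrite -imset_comp; apply: eq_imset => L /=; rewrite -imset_comp.
by apply: eq_imset => v /=; rewrite mulmxA.
Qed.

Lemma sqrt_exists (x : F) : exists s, s ^+ 2 = x.
Proof.
have /codomP[s ->] : x \in codom (fun s : F => s ^+ 2); last by exists s.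
apply: inj_card_onto => //.
by move=> s t; rewrite !expr2 => /(sqr_inj2 ch2).
Qed.

(** Dividing a representative by a square root of its determinant. *)
Lemma PGL2_rep (x : coset_of Z) : x \in PGL2 F ->
  exists2 g : {'GL_2[F]}, \det (GLval g) = 1 & x = coset Z g.
Proof.
case/morphimP=> g0 _ _ ->; have [s s2] := sqrt_exists (\det (GLval g0)).
have s0 : s != 0.
  by apply: contraTneq isT => s0; have := GL_det g0; rewrite -s2 s0 expr0n eqxx.
have si0 : s^-1 != 0 by rewrite invr_eq0.
exists (g0 * mkGL s^-1%:M)%g; last by rewrite coset_kerr ?mkGL_scalar_center.
rewrite GL_ME mkGLK ?unitmxE ?det_scalar ?unitrX ?unitfE //.
by rewrite det_mulmx det_scalar -s2 -exprMn divff ?expr1n.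
Qed.

(** [M] consists of all representatives of determinant 1 of elements of [I].  If
    g and h agree on a 3-set S, then g h^-1 fixes S, and
    det (g + h) = det (g h^-1 + 1) = tr (g h^-1). *)
Lemma card_intersecting_le (I : {set coset_of Z}) :
  I \subset PGL2 F -> intersecting (PGL2_set_action F) (three_subsets F) I ->
  exists2 M : {set 'M[F]_2}, det_family M & (#|I| <= #|M|)%N.
Proof.
move=> IP /forallP Iint.
pose G := [set g : {'GL_2[F]} | (\det (GLval g) == 1) && (coset Z g \in I)].
exists [set GLval g | g in G]; last first.
  rewrite card_imset; last exact: val_inj.
  apply: leq_trans (leq_imset_card (coset Z) G); apply/subset_leq_card/subsetP=> x xI.
  have [g g1 xg] := PGL2_rep (subsetP IP x xI).
  by rewrite xg imset_f // inE g1 eqxx -xg.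
split=> [_ /imsetP[g gG ->]|_ _ /imsetP[g gG ->] /imsetP[h hG ->]].
  by move: gG; rewrite inE => /andP[/eqP].
move: gG hG; rewrite !inE => /andP[/eqP g1 gI] /andP[/eqP h1 hI].
have := Iint (coset Z g); rewrite gI /= => /forallP/(_ (coset Z h)); rewrite hI /=.
case/existsP=> S /andP[SV /eqP]; have := SV; rewrite inE => /andP[SP _].
rewrite !PGL2_set_actionE // => gh.
have hu : GLval h \in unitmx by rewrite unitmxE h1 unitr1.
have A1 : \det (GLval g *m invmx (GLval h)) = 1.
  by rewrite det_mulmx det_inv g1 h1 invr1 mulr1.
have -> : GLval g + GLval h = (GLval g *m invmx (GLval h) + 1) *m GLval h.
  by rewrite mulmxDl mul1mx mulmxKV.
rewrite det_mulmx h1 mulr1 det_add1 //; apply: trace_fixed_three_subset A1 SV _.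
rewrite set_action_mulmx gh -set_action_mulmx mulmxV //.
rewrite -[RHS]imset_id; apply: eq_imset => L /=.
by rewrite -[RHS]imset_id; apply: eq_imset => v /=; rewrite mulmx1.
Qed.
End Char2.

(** * Orders of the group and of the set of 3-subsets *)

Local Notation q := #|F|.

Lemma card_GL2_center : #|Z| = q.-1.
Proof.
have inj : {in [set~ (0 : F)] &, injective (fun a => mkGL a%:M)}.
  move=> a b; rewrite !inE => a0 b0 /(congr1 (@GLval _ _)).
  rewrite !mkGLK ?unitmxE ?det_scalar ?unitrX ?unitfE // => /matrixP/(_ 0 0).
  by rewrite !mxE.
rewrite -(cardsC1 (0 : F)) -(card_in_imset inj); apply: eq_card => z.
apply/idP/imsetP=> [zZ|[a aC ->]]; last first.
  by apply: mkGL_scalar_center; move: aC; rewrite !inE.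
have [a a0 za] := GL2_center_scalar zZ; exists a; rewrite ?inE //.
by apply: val_inj; rewrite -![val _]/(GLval _) mkGLK // unitmxE det_scalar unitrX ?unitfE.
Qed.

Lemma card_PGL2 : #|PGL2 F| = (q.+1 * q * q.-1)%N.
Proof.
have q1 : (0 < q.-1)%N by rewrite -subn1 subn_gt0 finNzRing_gt1.
apply/eqP; rewrite -(eqn_pmul2l q1); apply/eqP.
rewrite -[in LHS]card_GL2_center card_quotient; last exact: normal_norm (center_normal _).
rewrite Lagrange ?center_sub // card_GL_2; ring.
Qed.

Definition mkrow (x y : F) : 'rV[F]_2 := \row_j if j == 0 then x else y.
Definition pt x := line (mkrow x 1).
Definition ptinf := line (mkrow 1 0).

Lemma pt_inj : injective pt.
Proof.
move=> x y E; have := mem_line (mkrow x 1); rewrite -/(pt x) E => /imsetP[a _ /rowP E'].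
have := E' 1; rewrite !mxE /= mulr1 => a1; have := E' 0.
by rewrite !mxE /= -a1 mul1r.
Qed.

Lemma pt_neq_inf x : pt x != ptinf.
Proof.
apply/eqP=> E; have := mem_line (mkrow x 1); rewrite -/(pt x) E => /imsetP[a _ /rowP E'].
by have /eqP := E' 1; rewrite !mxE /= mulr0 oner_eq0.
Qed.

Lemma projective_lineE : projective_line F = ptinf |: [set pt x | x : F].
Proof.
apply/setP=> L; rewrite in_setU1; apply/imsetP/idP=> [[v]|].
  rewrite inE => v0 ->; rewrite -/(line v).
  have [v1|v1] := eqVneq (v 0 1) 0.
    have vE : v = v 0 0 *: mkrow 1 0 by apply: row2P; rewrite !mxE /= ?mulr1 ?mulr0.
    by rewrite vE line_scale ?eqxx //; apply: contraNneq v0 => v00; rewrite vE v00 scale0r.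
  have vE : v = v 0 1 *: mkrow (v 0 0 / v 0 1) 1.
    by apply: row2P; rewrite !mxE /= ?mulr1 // mulrC divfK.
  by rewrite vE line_scale // -/(pt _) imset_f ?orbT.
case/orP=> [/eqP->|/imsetP[x _ ->]].
  exists (mkrow 1 0) => //; rewrite inE; apply/eqP=> /rowP/(_ 0)/eqP.
  by rewrite !mxE oner_eq0.
exists (mkrow x 1) => //; rewrite inE; apply/eqP=> /rowP/(_ 1)/eqP.
by rewrite !mxE oner_eq0.
Qed.

Lemma card_projective_line : #|projective_line F| = q.+1.
Proof.
rewrite projective_lineE cardsU1 card_imset ?add1n; last exact: pt_inj.
rewrite (_ : ptinf \notin _) //; apply/imsetP=> -[x _ /esym/eqP].
by rewrite (negbTE (pt_neq_inf x)).
Qed.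

Lemma card_three_subsets : (#|three_subsets F| * 6 = #|PGL2 F|)%N.
Proof.
rewrite cards_draws card_projective_line card_PGL2 -[6%N]/(3`!) bin_ffact.
by rewrite !ffactnSr ffactn0 mul1n subn0 !subSS subn0 subn1.
Qed.

(** * The intersecting family of affine maps *)

Section Affine.
Hypothesis ch2 : 2%N \in [pchar F].

(** With matrices acting on row vectors on the right, this is the map
    x |-> a x + b on the affine points [pt x]. *)
Definition aff (a b : F) : {'GL_2[F]} := mkGL (mx22 a 0 b 1).

Lemma affE a b : a != 0 -> GLval (aff a b) = mx22 a 0 b 1.
Proof.
by move=> a0; rewrite mkGLK // unitmxE det_mx22 !mxE /= mulr1 mul0r subr0 unitfE.
Qed.

Lemma mulmx_aff a b x y : a != 0 -> mkrow x y *m GLval (aff a b) = mkrow (a * x + b * y) y.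
Proof.
by move=> a0; rewrite affE //; apply: row2P; rewrite mulmx_row2E !mxE /=; ring.
Qed.

Lemma aff_pt a b x : a != 0 -> [set v *m GLval (aff a b) | v in pt x] = pt (a * x + b).
Proof. by move=> a0; rewrite line_mulmx mulmx_aff // mulr1. Qed.

Lemma aff_inf a b : a != 0 -> [set v *m GLval (aff a b) | v in ptinf] = ptinf.
Proof.
move=> a0; rewrite line_mulmx mulmx_aff // /ptinf -(line_scale (mkrow 1 0) a0).
by congr line; apply: row2P; rewrite !mxE /=; ring.
Qed.

(** Two representatives of a coset differ by a scalar, here 1 because both have
    lower right entry 1. *)
Lemma coset_aff_inj : {in [set p : F * F | p.1 != 0] &,
  injective (fun p => coset Z (aff p.1 p.2))}.
Proof.
move=> [a b] [a' b']; rewrite !inE /= => a0 a0' E.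
have gN (g : {'GL_2[F]}) : g \in 'N(Z)%g.
  exact: (subsetP (normal_norm (center_normal _)) _ (in_setT g)).
have /(rcoset_kercosetP (gN _) (gN _))/rcosetP[z zZ Ez] := E.
have [c c0 zE] := GL2_center_scalar zZ.
move/(congr1 (@GLval _ _)): Ez; rewrite GL_ME zE !affE // -mulmxE mul_scalar_mx.
move/matrixP=> Em; have := Em 0 0; have := Em 1 0; have := Em 1 1.
by rewrite !mxE /= mulr1 => <-; rewrite !mul1r => -> ->.
Qed.

Definition mu3 : {set F} := [set z | z ^+ 3 == 1].

Lemma mu3_neq0 z : z \in mu3 -> z != 0.
Proof. by rewrite inE; apply: contraTneq => ->; rewrite expr0n /= eq_sym oner_eq0. Qed.

Lemma card_mu3 (w : F) : w \in mu3 -> w != 1 -> #|mu3| = 3%N.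
Proof.
rewrite inE => /eqP w3 w1; apply/eqP; rewrite eqn_leq; apply/andP; split.
  rewrite cardE; apply: (@max_unity_roots F 3); rewrite ?enum_uniq //.
  by apply/allP=> z; rewrite mem_enum inE unity_rootE.
have w0 : w != 0 by apply: mu3_neq0; rewrite inE w3.
have ww : w * w != w by rewrite -[X in _ != X]mulr1 (inj_eq (mulfI w0)).
have ww1 : w * w != 1.
  apply: contra w1 => /eqP E; rewrite -w3 !exprS expr0 mulr1 E mulr1 eqxx //.
apply/card_gt2P; exists 1, w, (w * w); split; split; rewrite ?inE //.
- by rewrite expr1n.
- by rewrite w3.
- by rewrite -expr2 -exprM mulnC exprM w3 expr1n.
- by rewrite eq_sym.
- by rewrite eq_sym.
Qed.

Lemma mu3M a : a \in mu3 -> [set a * z | z in mu3] = mu3.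
Proof.
move=> am; have a0 := mu3_neq0 am; move: am; rewrite inE => /eqP a3.
apply/eqP; rewrite eqEcard card_imset ?leqnn ?andbT; last exact: mulfI.
by apply/subsetP=> _ /imsetP[z zm ->]; move: zm; rewrite !inE exprMn a3 mul1r.
Qed.

Definition affine_family : {set coset_of Z} :=
  [set coset Z (aff p.1 p.2) | p in setX mu3 [set: F]].

Lemma card_affine_family : #|affine_family| = (#|mu3| * q)%N.
Proof.
rewrite card_in_imset ?cardsX ?cardsT // => -[a b] [a' b'] /setXP[pm _] /setXP[pm' _].
by apply: coset_aff_inj; rewrite inE mu3_neq0.
Qed.

Lemma affine_family_sub : affine_family \subset PGL2 F.
Proof.
apply/subsetP=> _ /imsetP[p _ ->]; apply: mem_quotient; exact: in_setT.
Qed.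

Lemma finite_three_subset p (X : {set F}) (S := [set pt (p + z) | z in X]) :
  #|X| = 3%N -> S \in three_subsets F.
Proof.
move=> X3; rewrite inE card_imset ?X3 ?eqxx ?andbT; last by move=> x y /pt_inj/addrI.
apply/subsetP=> _ /imsetP[z _ ->]; rewrite projective_lineE in_setU1 imset_f ?orbT //.
Qed.

Lemma inf_three_subset x y : x != y -> [set ptinf; pt x; pt y] \in three_subsets F.
Proof.
move=> xy; rewrite inE -setUA !cardsU1 cards1 !inE (inj_eq pt_inj) (negbTE xy).
rewrite ![ptinf == _]eq_sym !(negbTE (pt_neq_inf _)) /= eqxx andbT.
apply/subsetP=> L; rewrite !inE projective_lineE in_setU1.
by case/or3P=> /eqP->; rewrite ?eqxx // imset_f ?orbT.
Qed.

Lemma affine_family_intersecting :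
  intersecting (PGL2_set_action F) (three_subsets F) affine_family.
Proof.
apply/forallP=> x; apply/implyP=> /imsetP[[a b] /setXP[/= am _] ->].
apply/forallP=> y; apply/implyP=> /imsetP[[a' b'] /setXP[/= am' _] ->].
have a0 := mu3_neq0 am; have a0' := mu3_neq0 am'.
have subP S : S \in three_subsets F -> S \subset projective_line F.
  by rewrite inE => /andP[].
have [aa'|aa'] := eqVneq a a'.
  (* Both maps send {0, c} to {b, b'}; if b = b' they are equal and any 3-set
     will do. *)
  pose c := if b == b' then 1 else (b + b') / a.
  have c0 : 0 != c.
    rewrite eq_sym /c; case: ifPn; rewrite ?oner_eq0 // => bb'.
    by rewrite mulf_neq0 ?invr_eq0 // addr_eq0 (oppr_pchar2 ch2).
  apply/existsP; exists [set ptinf; pt 0; pt c].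
  have SV := inf_three_subset c0; rewrite SV !PGL2_set_actionE ?subP //.
  rewrite -aa' !imsetU !imset_set1 !aff_inf // !aff_pt // mulr0 !add0r.
  rewrite /c; have [->|_] := eqVneq b b'; first by rewrite eqxx.
  rewrite (mulrC a) divfK //=.
  have -> : b + b' + b = b' by rewrite addrAC (addrr_pchar2 ch2) add0r.
  have -> : b + b' + b' = b by rewrite -addrA (addrr_pchar2 ch2) addr0.
  by rewrite setUAC eqxx.
pose p := (b + b') / (a + a').
have aa0 : a + a' != 0 by rewrite addr_eq0 (oppr_pchar2 ch2).
have ap : a * p + b = a' * p + b'.
  apply: (eq_of_add0 ch2); rewrite addrACA -mulrDl mulrC divfK // (addrr_pchar2 ch2) //.
have cm : #|mu3| = 3%N.
  apply: (@card_mu3 (a / a')).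
    move: am am'; rewrite !inE => /eqP am /eqP am'.
    by rewrite exprMn exprVn am am' invr1 mulr1.
  by apply: contra aa' => /eqP E; rewrite -(divfK a0' a) E mul1r.
apply/existsP; exists [set pt (p + z) | z in mu3].
have SV := finite_three_subset p cm; rewrite SV !PGL2_set_actionE ?subP //.
have img (u d : F) : u \in mu3 -> [set [set v *m GLval (aff u d) | v in L]
      | L : {set 'rV[F]_2} in [set pt (p + z) | z in mu3]] =
    [set pt (u * p + d + z) | z in mu3].
  move=> um; rewrite -{2}(mu3M um) -!imset_comp; apply: eq_imset => z /=.
  by rewrite aff_pt ?mu3_neq0 //; congr pt; ring.
by rewrite !img // ap eqxx.
Qed.
End Affine.
End Lines.

(** * The density *)

Section Density.
Variable F : finFieldType.
Hypothesis ch2 : 2%N \in [pchar F].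

Let rho := intersection_density (PGL2_set_action F) (PGL2 F) (three_subsets F).

Lemma density_ratio (n : nat) :
  n%:R * #|three_subsets F|%:R / #|PGL2 F|%:R = n%:R / 6%:R :> rat.
Proof.
have V0 : #|three_subsets F|%:R != 0 :> rat.
  by rewrite pnatr_eq0; apply/eqP=> V0; have := card_three_subsets F;
     rewrite V0 mul0n => /esym/eqP; rewrite -leqn0 leqNgt cardG_gt0.
by rewrite -card_three_subsets natrM; field.
Qed.

Lemma density_eq n : (forall M : {set 'M[F]_2}, det_family M -> (#|M| <= n)%N) ->
  (n <= #|mu3 F| * #|F|)%N -> rho = n%:R / 6%:R.
Proof.
move=> le_n n_le; apply/eqP; rewrite eq_le; apply/andP; split.
  apply: bigmax_le => [|I /andP[IP Iint]]; first by rewrite divr_ge0 ?ler0n.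
  rewrite density_ratio ler_pM2r ?invr_gt0 ?ltr0n // ler_nat.
  have [M MP le_IM] := card_intersecting_le ch2 IP Iint.
  exact: leq_trans le_IM (le_n _ MP).
apply: (@bigmax_sup _ _ _ _ (affine_family F)).
  by rewrite affine_family_sub affine_family_intersecting.
by rewrite density_ratio ler_pM2r ?invr_gt0 ?ltr0n // ler_nat card_affine_family.
Qed.

Lemma mu3_1 : 1 \in mu3 F.
Proof. by rewrite inE expr1n. Qed.

(** The group of units of [F] has order q - 1, so Cauchy's theorem applies. *)
Lemma card_mu3_dvd : (3 %| #|F|.-1)%N -> #|mu3 F| = 3%N.
Proof.
rewrite -card_finField_unit => /Cauchy[//|u _ ou].
have u3 : (u ^+ 3)%g = 1%g by rewrite -ou expg_order.
apply: (@card_mu3 _ (val u)).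
  by rewrite inE -[val u]/(FinRing.uval u) -FinRing.val_unitX u3.
by apply/eqP=> u1; move: ou; rewrite (_ : u = 1%g) ?order1 //; apply: val_inj.
Qed.

(** A root x would satisfy x^3 = 1.  The order q of [F] is 2 modulo 3, so
    x^q = x would give x^2 = x. *)
Lemma X2_X_1_no_root (l : nat) : #|F| = (2 ^ (2 * l + 1))%N ->
  forall x : F, x * x + x + 1 != 0.
Proof.
move=> cF x; apply/eqP=> E.
have x3 : x ^+ 3 = 1.
  apply/eqP; rewrite -subr_eq0; apply/eqP; transitivity ((x - 1) * (x * x + x + 1)).
    by rewrite !exprS; ring.
  by rewrite E mulr0.
have q2 : (#|F| %% 3 = 2)%N.
  by rewrite cF expnD expnM -modnMml -modnXm exp1n.
have xx : x * x = x.
  by rewrite -[RHS]expf_card (divn_eq #|F| 3) q2 exprD mulnC exprM x3 expr1n mul1r.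
by move: E; rewrite xx (addrr_pchar2 ch2) add0r => /eqP; rewrite oner_eq0.
Qed.
End Density.

Theorem theorem3p1 (F : finFieldType) (q l : nat) (cardF : #|F| = q)
    (q_even : ~~ odd q) (l_gt0 : (0 < l)%N) :
  let rho := intersection_density (PGL2_set_action F) (PGL2 F)
               (three_subsets F) in
  (q = (2 ^ (2 * l + 1))%N -> rho = q%:R / 6%:R) /\
  (q = (2 ^ (2 * l))%N -> rho = q%:R / 2%:R).
Proof.
have pow2_char n : q = (2 ^ n)%N -> 2%N \in [pchar F].
  by move=> qn; apply: (@card_finPcharP _ 2 n); rewrite ?cardF.
split=> qE; have ch2 := pow2_char _ qE.
  apply: (density_eq ch2) => [M MP|].
    rewrite -cardF; apply: (card_det_family ch2 MP).2.
      by rewrite cardF qE -[8%N]/(2 ^ 3)%N leq_exp2l // addn1 ltnS leq_pmulr.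
    by apply: (X2_X_1_no_root ch2 (l := l)); rewrite cardF.
  rewrite cardF leq_pmull //; apply/card_gt0P; exists 1; exact: mu3_1.
have mu3_3 : #|mu3 F| = 3%N.
  apply: card_mu3_dvd; rewrite cardF qE expnM -subn1 -eqn_mod_dvd ?expn_gt0 //.
  by rewrite -modnXm exp1n.
have -> : q%:R / 2%:R = (q * 3)%:R / 6%:R :> rat by rewrite natrM; field.
apply: (density_eq ch2) => [M MP|]; last by rewrite mu3_3 cardF mulnC.
rewrite -cardF; apply: (card_det_family ch2 MP).1.
by rewrite cardF qE -[4%N]/(2 ^ 2)%N leq_exp2l // leq_pmulr.
Qed.
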